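(* Let $G$ be an undirected graph with vertex set $[n]=\{1,\ldots,n\}$, let $I(G)\subset\mathbb{K}[x_1,\ldots,x_n]$ be its edge ideal, and let $r\ge 1$. The $r$-th secant $I(G)^{\{r\}}$ is generated by the squarefree monomials $m_V$ whose subgraph $G_V$ is not $r$-colorable: $$I(G)^{\{r\}}=\langle\, m_V \;|\; V\subseteq[n],\ \chi(G_V)>r\,\rangle.$$ The minimal generators of $I(G)^{\{r\}}$ are those monomials $m_V$ such that $G_V$ is not $r$-colorable but $G_U$ is $r$-colorable for every proper subset $U\subset V$.
   Context: $\mathbb{K}$ is a field. The edge ideal $I(G)$ is generated by the squarefree monomials $x_ix_j$ with $\{i,j\}$ an edge of $G$. For $V\subseteq[n]$, $m_V=\prod_{i\in V}x_i$ and $G_V$ is the subgraph of $G$ induced on $V$. A graph is $r$-colorable if its vertices can be colored with at most $r$ colors so that adjacent vertices have different colors; $\chi$ denotes the chromatic number. Secants: for an ideal $I\subset\mathbb{K}[\mathbf{x}]=\mathbb{K}[x_1,\ldots,x_n]$ and $r\ge1$, introduce new variables $\mathbf{y}_j=(y_{j1},\ldots,y_{jn})$, $j=1,\ldots,r$, and let $I(\mathbf{y}_j)$ be the image of $I$ under $\mathbf{x}\mapsto\mathbf{y}_j$. The $r$-th secant of $I$ (the $r$-fold join $I*\cdots*I$) is $$I^{\{r\}}=\Bigl(I(\mathbf{y}_1)+\cdots+I(\mathbf{y}_r)+\langle y_{1i}+\cdots+y_{ri}-x_i : 1\le i\le n\rangle\Bigr)\cap\mathbb{K}[\mathbf{x}].$$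 *)

(* Defs.v *)
From HB Require Import structures.
From mathcomp Require Import all_boot all_order all_algebra.
From mathcomp Require Import mpoly.
Set Implicit Arguments.
Unset Strict Implicit.
Unset Printing Implicit Defensive.
Import GRing.Theory.
Local Open Scope ring_scope.

Record sgraph (T : finType) := SGraph {
  edge :> rel T;
  edge_sym : forall x y, edge x y = edge y x;
  edge_irr : irreflexive edge
}.

Section Graphs.
Variable T : finType.
Implicit Types (G : sgraph T) (V : {set T}).

Definition colorable G (r : nat) : bool :=
  [exists c : {ffun T -> 'I_r}, forall x, forall y, edge G x y ==> (c x != c y)].

Lemma colorable_ex G : exists r, colorable G r.
Proof.
exists #|T|; apply/existsP; exists [ffun x => enum_rank x].
apply/forallP=> x; apply/forallP=> y; apply/implyP=> exy; rewrite !ffunE.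
by apply: contraTneq exy => /enum_rank_inj ->; rewrite edge_irr.
Qed.

Definition chi G : nat := ex_minn (colorable_ex G).

Definition induced_rel G V : rel {x : T | x \in V} :=
  fun x y => edge G (val x) (val y).

Lemma induced_sym G V : forall x y, @induced_rel G V x y = @induced_rel G V y x.
Proof. by move=> x y; apply: edge_sym. Qed.

Lemma induced_irr G V : irreflexive (@induced_rel G V).
Proof. by move=> x; apply: edge_irr. Qed.

Definition induced G V : sgraph {x : T | x \in V} :=
  SGraph (@induced_sym G V) (@induced_irr G V).

End Graphs.

(* Subsets of a ring, ideals among them, are Prop-valued predicates. *)

Definition ideal_gen (R : comNzRingType) (S : R -> Prop) (p : R) : Prop :=
  exists (k : nat) (a g : 'I_k -> R),
    (forall i, S (g i)) /\ p = \sum_(i < k) a i * g i.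

Section Secant.
Variables (K : fieldType) (n r : nat).

(* K[x, y_1, ..., y_r] is {mpoly K[n + r * n]}: the first n variables are the
   x_i, the remaining r * n are the y_ji, indexed through mxvec_index. *)
Definition xvar (i : 'I_n) : {mpoly K[n + r * n]} := 'X_(lshift (r * n) i).
Definition yvar (j : 'I_r) (i : 'I_n) : {mpoly K[n + r * n]} :=
  'X_(rshift n (mxvec_index j i)).

Definition subst_x (f : {mpoly K[n]}) : {mpoly K[n + r * n]} :=
  f \mPo [tuple xvar i | i < n].
Definition subst_y (j : 'I_r) (f : {mpoly K[n]}) : {mpoly K[n + r * n]} :=
  f \mPo [tuple yvar j i | i < n].

Definition secant_gens (I : {mpoly K[n]} -> Prop) (g : {mpoly K[n + r * n]}) :
    Prop :=
  (exists (j : 'I_r) (f : {mpoly K[n]}), I f /\ g = subst_y j f) \/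
  (exists i : 'I_n, g = \sum_(j < r) yvar j i - xvar i).

Definition secant (I : {mpoly K[n]} -> Prop) (f : {mpoly K[n]}) : Prop :=
  ideal_gen (secant_gens I) (subst_x f).

End Secant.

Section MonomialIdeals.
Variables (K : fieldType) (n : nat).
Implicit Types (I M N : {mpoly K[n]} -> Prop).

Definition edge_ideal (G : sgraph 'I_n) : {mpoly K[n]} -> Prop :=
  ideal_gen (fun f => exists i j : 'I_n, edge G i j /\ f = 'X_i * 'X_j).

Definition mV (V : {set 'I_n}) : {mpoly K[n]} := \prod_(i in V) 'X_i.

Definition generates M I : Prop := forall f, I f <-> ideal_gen M f.

(* M is an inclusion-minimal set of monomials generating I. *)
Definition minimal_generators I M : Prop :=
  [/\ forall f, M f -> exists m : 'X_{1..n}, f = 'X_[m],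
      generates M I
    & forall N, (forall f, N f -> M f) -> generates N I ->
        forall f, M f -> N f].

End MonomialIdeals.

(* Main.v *)
(** The join ideal is monomial after eliminating the [x_i]: it is generated by
    the [y_ja y_jb] for edges [ab] and colors [j]. Modulo it, the image
    [\prod_(i in V) \sum_j y_ji] of [m_V] expands into a sum over all colorings
    of [V], and a term vanishes when its coloring has a monochromatic edge; so
    [m_V] is in the secant if [G_V] is not [r]-colorable. Conversely, a proper
    coloring [c] of [G_U] defines the substitution sending [y_ji] to [x_i] if
    [i \in U] and [c i = j], and to [0] otherwise. It kills the join ideal and
    preserves the coefficients of the monomials supported on [U], so that these
    do not occur in elements of the secant. *)
Require Import Defs.
From HB Require Import structures.
From mathcomp Require Import all_boot all_order all_algebra.
From mathcomp Require Import mpoly.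
Set Implicit Arguments.
Unset Strict Implicit.
Unset Printing Implicit Defensive.
Import GRing.Theory.
Local Open Scope ring_scope.

(** * Ideals generated by a set in a commutative ring *)

Section IdealGen.
Variables (R : comNzRingType).
Implicit Types (S T : R -> Prop) (p q : R).

Lemma ideal_gen_mem S p : S p -> ideal_gen S p.
Proof.
by move=> Sp; exists 1, (fun=> 1), (fun=> p); rewrite big_ord1 mul1r.
Qed.

Lemma ideal_gen0 S : ideal_gen S 0.
Proof. by exists 0, (fun=> 0), (fun=> 0); rewrite big_ord0; split=> // -[]. Qed.

Lemma ideal_genD S p q : ideal_gen S p -> ideal_gen S q -> ideal_gen S (p + q).
Proof.
move=> [k [a [g [Sg ->]]]] [l [b [h [Sh ->]]]].
pose cat (u : 'I_k -> R) v (i : 'I_(k + l)) :=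
  match split i with inl x => u x | inr y => v y end.
exists (k + l)%N, (cat a b), (cat g h); split=> [i|].
  by rewrite /cat; case: split.
rewrite big_split_ord; congr (_ + _); apply: eq_bigr => i _ /=; rewrite /cat.
  case: split_ordP => j /(congr1 val) /= => [/val_inj <- //|e].
  by move: (ltn_ord i); rewrite e ltnNge leq_addr.
case: split_ordP => j /(congr1 val) /= => [e|/addnI /val_inj <- //].
by move: (ltn_ord j); rewrite -e ltnNge leq_addr.
Qed.

Lemma ideal_genMl S p q : ideal_gen S q -> ideal_gen S (p * q).
Proof.
move=> [k [a [g [Sg ->]]]]; exists k, (fun i => p * a i), g; split=> //.
by rewrite mulr_sumr; apply: eq_bigr => i _; rewrite mulrA.
Qed.

Lemma ideal_gen_sum S (I : Type) (s : seq I) (P : pred I) (F : I -> R) :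
  (forall i, P i -> ideal_gen S (F i)) -> ideal_gen S (\sum_(i <- s | P i) F i).
Proof.
by move=> SF; apply: big_ind => //; [apply: ideal_gen0 | apply: ideal_genD].
Qed.

Lemma ideal_gen_trans S T p :
  (forall q, S q -> ideal_gen T q) -> ideal_gen S p -> ideal_gen T p.
Proof.
move=> ST [k [a [g [Sg ->]]]].
by apply: ideal_gen_sum => i _; apply/ideal_genMl/ST/Sg.
Qed.

(** Congruence modulo an ideal passes to products, by exchanging one factor at a time. It serves to
    replace each [x_i] by the sum of the [y_ji]. *)
Lemma ideal_gen_prodB S (I : Type) (s : seq I) (P : pred I) (F H : I -> R) :
  (forall i, P i -> ideal_gen S (F i - H i)) ->
  ideal_gen S (\prod_(i <- s | P i) F i - \prod_(i <- s | P i) H i).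
Proof.
move=> SFH; elim/big_rec2: _ => [|i x y Pi Sxy].
  by rewrite subrr; apply: ideal_gen0.
have -> : F i * y - H i * x = F i * (y - x) + x * (F i - H i).
  by rewrite !mulrBr !(mulrC x) addrA subrK.
by apply: ideal_genD; apply: ideal_genMl => //; apply: SFH.
Qed.

End IdealGen.

Lemma ideal_gen_kernel (R R' : comNzRingType) (phi : {rmorphism R -> R'})
    (S : R -> Prop) p :
  (forall q, S q -> phi q = 0) -> ideal_gen S p -> phi p = 0.
Proof.
move=> phiS [k [a [g [Sg ->]]]]; rewrite rmorph_sum big1 // => i _.
by rewrite rmorphM (phiS _ (Sg i)) mulr0.
Qed.

(** * Membership in monomial ideals, term by term *)

Section MonomialIdeals.
Variables (K : fieldType) (n : nat).
Implicit Types (m : 'X_{1..n}) (V : {set 'I_n}) (M : {mpoly K[n]} -> Prop).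

Definition mnm_supp m : {set 'I_n} := [set i | m i != 0%N].

(** [mesym1 V] is the 0/1 indicator of [V] as an exponent vector. *)
Lemma mVE V : mV K V = 'X_[mesym1 V].
Proof.
rewrite mpolyXE_id /mV [RHS](bigID (mem V)) /= -[LHS]mulr1; congr (_ * _).
  by apply: eq_bigr => i iV; rewrite mnmE iV expr1.
by rewrite big1 // => i /negPf iV; rewrite mnmE iV expr0.
Qed.

Lemma mesym1_le V m : (mesym1 V <= m)%MM = (V \subset mnm_supp m).
Proof.
apply/mnm_lepP/subsetP => [le_Vm i iV | Vm i].
  by rewrite inE -lt0n (leq_trans _ (le_Vm i)) // mnmE iV.
by rewrite mnmE; case: (boolP (i \in V)) => [/Vm|//]; rewrite inE -lt0n.
Qed.

Lemma mnm_supp_mesym1 V : mnm_supp (mesym1 V) = V.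
Proof. by apply/setP => i; rewrite inE mnmE; case: (i \in V). Qed.

Lemma mnm_suppS m m' : (m <= m')%MM -> mnm_supp m \subset mnm_supp m'.
Proof.
move/mnm_lepP=> le_mm; apply/subsetP => i; rewrite !inE -!lt0n => /leq_trans.
exact.
Qed.

(** Every term of a multiple of a monomial is divisible by that monomial; conversely, [f] is the sum
    of its terms. *)
Lemma ideal_gen_monomialP M f : (forall g, M g -> exists m, g = 'X_[m]) ->
  ideal_gen M f <->
  forall m, m \in msupp f -> exists2 m', M 'X_[m'] & (m' <= m)%MM.
Proof.
move=> monM; split=> [[k [a [g [Mg ->]]]] m | Mf].
  move/msupp_sum_le/flattenP => [s /mapP[i _ ->]].
  have [m' Em'] := monM _ (Mg i); rewrite Em' (perm_mem (msuppMX _ _)).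
  by move=> /mapP[m2 _ ->]; exists m'; [rewrite -Em' | apply: lem_addr].
rewrite [f]mpolyE big_seq; apply: ideal_gen_sum => m /Mf[m' Mm' le_mm].
rewrite -(submK le_mm) mpolyXD -mul_mpolyC mulrA.
exact/ideal_genMl/ideal_gen_mem.
Qed.

Lemma ideal_gen_mVP (P : {set 'I_n} -> Prop) f :
  ideal_gen (fun g => exists V, P V /\ g = mV K V) f <->
  forall m, m \in msupp f -> exists2 V, P V & V \subset mnm_supp m.
Proof.
rewrite ideal_gen_monomialP; last first.
  by move=> g [V [_ ->]]; exists (mesym1 V); rewrite mVE.
split=> Pf m /Pf[].
  move=> m' [V [PV]]; rewrite mVE.
  move=> /(congr1 (fun p : {mpoly K[n]} => msupp p)).
  by rewrite !msuppX => -[->]; rewrite mesym1_le; exists V.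
move=> V PV sVm; exists (mesym1 V); last by rewrite mesym1_le.
by exists V; rewrite mVE.
Qed.

End MonomialIdeals.

(** * Colorings of induced subgraphs *)

Section Colorings.
Variables (T : finType) (G : sgraph T).
Implicit Types (U V : {set T}).

(** Colorings defined on all of [T] avoid the subtype of vertices in [V]. *)
Lemma colorable_inducedP V (r : nat) : (0 < r)%N ->
  reflect (exists c : T -> 'I_r, {in V &, forall x y, edge G x y -> c x != c y})
          (colorable (induced G V) r).
Proof.
move=> r_gt0; apply: (iffP existsP) => [[c /forallP cP] | [c cP]].
  (* Vertices outside [V] get the default color 0, available since [r] is positive. *)
  exists (fun x => if insub x is Some u then c u else Ordinal r_gt0).
  move=> x y xV yV xy; rewrite !insubT.
  by move/forallP/(_ (Sub y yV))/implyP: (cP (Sub x xV)); apply.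
exists [ffun u => c (val u)]; apply/forallP=> x; apply/forallP=> y.
by apply/implyP=> xy; rewrite !ffunE; apply: cP => //; apply: valP.
Qed.

Lemma colorable_inducedS U V (r : nat) : (0 < r)%N ->
  U \subset V -> colorable (induced G V) r -> colorable (induced G U) r.
Proof.
move=> r_gt0 /subsetP sUV /(colorable_inducedP _ r_gt0)[c cP].
by apply/(colorable_inducedP _ r_gt0); exists c => x y /sUV xV /sUV; apply: cP.
Qed.

Lemma colorable_leq (r s : nat) : (r <= s)%N -> colorable G r -> colorable G s.
Proof.
move=> le_rs /existsP[c /forallP cP]; apply/existsP.
exists [ffun x => widen_ord le_rs (c x)].
apply/forallP=> x; apply/forallP=> y; apply/implyP=> xy; rewrite !ffunE.
by move/forallP/(_ y)/implyP/(_ xy): (cP x); apply: contraNneq => -[/val_inj->].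
Qed.

Lemma ltn_chi (r : nat) : (r < chi G)%N = ~~ colorable G r.
Proof.
rewrite ltnNge; congr (~~ _); rewrite /chi; case: ex_minnP => m Gm m_min.
by apply/idP/idP => [/colorable_leq | /m_min //]; apply.
Qed.

Definition minimal_uncolorable (r : nat) V : Prop :=
  ~~ colorable (induced G V) r /\
  forall U, U \proper V -> colorable (induced G U) r.

Lemma uncolorable_minimal_subset V (r : nat) : ~~ colorable (induced G V) r ->
  exists2 U, minimal_uncolorable r U & U \subset V.
Proof.
move=> VP; have [U /minsetP[UP Umin] sUV] :=
  @minset_exists _ (fun U => ~~ colorable (induced G U) r) _ VP.
exists U => //; split=> // W /properP[sWU [x xU xW]].
have [//|WP] := boolP (colorable (induced G W) r).
by rewrite (Umin W WP sWU) xU in xW.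
Qed.

End Colorings.

(** * Secants of edge ideals *)

Section Secant.
Variables (K : fieldType) (n r : nat) (G : sgraph 'I_n).
Hypothesis r_gt0 : (0 < r)%N.
Local Notation sec := (secant r (@edge_ideal K n G)).

Lemma subst_xX i : @subst_x K n r 'X_i = xvar K r i.
Proof. by rewrite /subst_x comp_mpolyXU -tnth_nth tnth_mktuple. Qed.

Lemma subst_yX (j : 'I_r) (i : 'I_n) : subst_y j 'X_i = yvar K j i.
Proof. by rewrite /subst_y comp_mpolyXU -tnth_nth tnth_mktuple. Qed.

Section ColoringSubstitution.
Variables (U : {set 'I_n}) (c : 'I_n -> 'I_r).

(** The row follows the layout of the variables: the [x_i] first, then the [y_ji] flattened by
    [mxvec]. Also [x_i] goes to 0 for [i] outside [U], as the linear generators of the join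
    require. *)
Definition coloring_subst : {mpoly K[n + r * n]} -> {mpoly K[n]} :=
  comp_mpoly [tuple row_mx (\row_i (if i \in U then 'X_i else 0))
    (mxvec (\matrix_(j, i) (if (i \in U) && (c i == j) then 'X_i else 0))) 0 k
  | k < n + r * n].

HB.instance Definition _ := GRing.LRMorphism.on coloring_subst.

Lemma coloring_subst_xvar i :
  coloring_subst (xvar K r i) = if i \in U then 'X_i else 0.
Proof.
by rewrite /coloring_subst comp_mpolyXU -tnth_nth tnth_mktuple row_mxEl mxE.
Qed.

Lemma coloring_subst_yvar j i :
  coloring_subst (yvar K j i) = if (i \in U) && (c i == j) then 'X_i else 0.
Proof.
rewrite /coloring_subst comp_mpolyXU -tnth_nth tnth_mktuple row_mxEr mxvecE.
by rewrite mxE.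
Qed.

(** Monomials supported on [U] are fixed; any other one goes to 0 and differs from [m]. *)
Lemma mcoeff_coloring_subst f m :
  mnm_supp m \subset U -> (coloring_subst (subst_x r f))@_m = f@_m.
Proof.
move=> sUm; rewrite [in LHS](mpolyE f) [in RHS](mpolyE f) /subst_x.
rewrite (raddf_sum (comp_mpoly [tuple xvar K r i | i < n])).
rewrite (raddf_sum coloring_subst) !(raddf_sum (mcoeff m)).
apply: eq_bigr => m' _; rewrite /= comp_mpolyZ linearZ_LR !mcoeffZ.
congr (_ * _); rewrite comp_mpolyX rmorph_prod.
under eq_bigr => i _ do rewrite rmorphXn tnth_mktuple /= coloring_subst_xvar.
have [sUm'|/subsetPn[i]] := boolP (mnm_supp m' \subset U).
  rewrite mpolyXE_id; congr (_@_m); apply: eq_bigr => i _; case: ifPn => // iU.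
  by have := contraNN (subsetP sUm' i) iU; rewrite inE negbK => /eqP->.
rewrite inE => m'i iU; rewrite (bigD1 i) //= (negPf iU) expr0n (negPf m'i).
rewrite mul0r mcoeff0 mcoeffX; case: eqP => // mm'; case/negP: iU.
by rewrite (subsetP sUm) // inE -mm'.
Qed.

(** In a linear generator only [y_ji] with [j = c i] can survive, and it cancels [x_i]. In
    [y_ja y_jb] both factors survive only if [a] and [b] lie in [U] and share the color [j], which
    an edge forbids. *)
Lemma coloring_subst_secant_gens q :
    {in U &, forall x y, edge G x y -> c x != c y} ->
  secant_gens (@edge_ideal K n G) q -> coloring_subst q = 0.
Proof.
move=> cP [[j [f [If ->]]] | [i ->]]; last first.
  rewrite rmorphB rmorph_sum /= coloring_subst_xvar.
  under eq_bigr => j _ do rewrite coloring_subst_yvar.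
  case: (i \in U) => /=; last by rewrite big1 ?subrr.
  by rewrite -big_mkcond (big_pred1 (c i)) ?subrr // => j; rewrite eq_sym.
apply: (ideal_gen_kernel (phi := coloring_subst \o @comp_mpoly _ _ _ _)) If.
move=> _ [a [b [ab ->]]]; rewrite rmorphM /= -!/(subst_y _ _) !subst_yX.
rewrite !coloring_subst_yvar.
case: (boolP ((a \in U) && _)) => [/andP[aU /eqP caj]|_]; last exact: mul0r.
case: (boolP ((b \in U) && _)) => [/andP[bU /eqP cbj]|_]; last exact: mulr0.
by have := cP a b aU bU ab; rewrite caj cbj eqxx.
Qed.

End ColoringSubstitution.

Lemma secant_uncolorable f m :
  sec f -> m \in msupp f -> ~~ colorable (induced G (mnm_supp m)) r.
Proof.
move=> secf; rewrite mcoeff_msupp; apply: contra.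
case/(colorable_inducedP _ _ r_gt0) => c cP.
rewrite -(mcoeff_coloring_subst c f (subxx _)).
rewrite (ideal_gen_kernel (phi := coloring_subst _ c) _ secf) ?mcoeff0 //.
by move=> q; apply: coloring_subst_secant_gens.
Qed.

Lemma secant_mV V : ~~ colorable (induced G V) r -> sec (mV K V).
Proof.
move=> VP; rewrite /secant /subst_x rmorph_prod /= -/(subst_x _ _).
under eq_bigr => i _ do rewrite -/(subst_x _ _) subst_xX.
pose Y := \prod_(i in V) \sum_(j < r) yvar K j i.
(* The image of [mV K V] is written as [Y] minus its difference with [Y]; both parts lie in the join
   ideal. *)
rewrite -[X in ideal_gen _ X](subKr Y); apply: ideal_genD.
  rewrite /Y (big_distr_big (Ordinal r_gt0)) /=.
  apply: ideal_gen_sum => c _.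
  have /exists_inP[a aV /exists_inP[b bV /andP[ab /eqP cab]]] :
      [exists a in V, exists b in V, edge G a b && (c a == c b)].
    apply: contraNT VP => /exists_inPn nP.
    apply/(colorable_inducedP _ _ r_gt0); exists c => a b aV bV ab.
    by apply: contra (nP a aV) => cab; apply/exists_inP; exists b; rewrite ?ab.
  (* Distinctness lets both factors be extracted from the product. *)
  have bVa : (b \in V) && (b != a).
    by rewrite bV; apply: contraTneq ab => ->; rewrite edge_irr.
  rewrite (bigD1 a) //= (bigD1 b) //= mulrA mulrC.
  apply/ideal_genMl/ideal_gen_mem.
  left; exists (c a), ('X_a * 'X_b); split.
    by apply: ideal_gen_mem; exists a, b.
  by rewrite /subst_y rmorphM /= -!/(subst_y _ _) !subst_yX cab.
rewrite -mulN1r; apply/ideal_genMl/ideal_gen_prodB => i _.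
by apply: ideal_gen_mem; right; exists i.
Qed.

Lemma secant_ideal_gen (M : {mpoly K[n]} -> Prop) f :
  (forall g, M g -> sec g) -> ideal_gen M f -> sec f.
Proof.
move=> Msec [k [a [g [Mg ->]]]]; rewrite /secant /subst_x rmorph_sum /=.
apply: ideal_gen_sum => i _; rewrite rmorphM; exact/ideal_genMl/Msec.
Qed.

(** The right-hand side is tested on each term separately, so the secant is a monomial ideal, and it
    depends only on supports, so it is squarefree. *)
Lemma secantP f :
  sec f <-> forall m, m \in msupp f -> ~~ colorable (induced G (mnm_supp m)) r.
Proof.
split=> [secf m | fP]; first exact: secant_uncolorable.
apply: (@secant_ideal_gen
  (fun g => exists V, ~~ colorable (induced G V) r /\ g = mV K V)).
  by move=> _ [V [VP ->]]; apply: secant_mV.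
by apply/ideal_gen_mVP => m /fP; exists (mnm_supp m).
Qed.

(** Uncolorability passes to larger vertex sets, so a family of uncolorable sets generates once
    every uncolorable set contains a member. This covers both all uncolorable sets and the minimal
    ones. *)
Lemma secant_generates (P : {set 'I_n} -> Prop) :
    (forall V, P V -> ~~ colorable (induced G V) r) ->
    (forall V, ~~ colorable (induced G V) r -> exists2 U, P U & U \subset V) ->
  generates (fun f => exists V, P V /\ f = mV K V) sec.
Proof.
move=> Pnc ncP f; rewrite secantP ideal_gen_mVP; split=> fP m /fP.
  exact: ncP.
move=> [V /Pnc + sVm]; apply: contra; exact: colorable_inducedS.
Qed.

Lemma minimal_uncolorable_generates :
  generates (fun f => exists V, minimal_uncolorable G r V /\ f = mV K V) sec.
Proof.
by apply: secant_generates => V; [case | apply: uncolorable_minimal_subset].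
Qed.

(** Some monomial of [M] divides [mV K V]. Its support is uncolorable and contained in [V], hence
    equal to [V] by minimality; being squarefree, it is [mV K V] itself. *)
Lemma minimal_uncolorable_mem_generators (M : {mpoly K[n]} -> Prop) V :
    (forall f, M f -> exists m, f = 'X_[m]) -> generates M sec ->
  minimal_uncolorable G r V -> M (mV K V).
Proof.
move=> monM genM [VP Vmin].
have /genM/(ideal_gen_monomialP _ monM) : sec (mV K V) by apply: secant_mV.
rewrite mVE => /(_ (mesym1 V)); rewrite msuppX inE eqxx => -[//|m Mm le_mV].
have mP : ~~ colorable (induced G (mnm_supp m)) r.
  have /genM/secantP := ideal_gen_mem Mm; apply.
  by rewrite msuppX inE.
have := mnm_suppS le_mV; rewrite mnm_supp_mesym1 subEproper.
case/orP=> [/eqP suppm|/Vmin]; last by rewrite (negPf mP).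
suff <- : m = mesym1 V by [].
apply/mnmP => i; apply/eqP; rewrite eqn_leq (mnm_lepP le_mV).
by apply: mnm_lepP; rewrite mesym1_le suppm.
Qed.

End Secant.

Theorem theorem3p2 (K : fieldType) (n r : nat) (G : sgraph 'I_n)
    (hr : (1 <= r)%N) :
  [/\ generates
        (fun f => exists V : {set 'I_n},
           ~~ colorable (induced G V) r /\ f = mV K V)
        (secant r (@edge_ideal K n G)),
      generates
        (fun f => exists V : {set 'I_n},
           (r < chi (induced G V))%N /\ f = mV K V)
        (secant r (@edge_ideal K n G))
    & forall M : {mpoly K[n]} -> Prop,
        minimal_generators (secant r (@edge_ideal K n G)) M <->
        (forall f, M f <->
           exists V : {set 'I_n},
             [/\ ~~ colorable (induced G V) r,
                 forall U : {set 'I_n}, U \proper V -> colorable (induced G U) r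
               & f = mV K V])].
Proof.
split.
- by apply: secant_generates => // V VP; exists V.
- apply: (secant_generates _ (P := fun V => r < chi (induced G V))%N) => // V.
    by rewrite ltn_chi.
  by rewrite -ltn_chi; exists V.
move=> M; pose Mmin f := exists V, minimal_uncolorable G r V /\ f = mV K V.
have MminP f : Mmin f <-> exists V : {set 'I_n},
    [/\ ~~ colorable (induced G V) r,
        forall U : {set 'I_n}, U \proper V -> colorable (induced G U) r
      & f = mV K V].
  by split=> [[V [[? ?] ?]]|[V [? ? ?]]]; exists V.
suff -> : minimal_generators (secant r (@edge_ideal K n G)) M <->
    (forall f, M f <-> Mmin f) by split=> MP f; rewrite MP MminP.
have monMmin f : Mmin f -> exists m, f = 'X_[m].
  by move=> [V [_ ->]]; exists (mesym1 V); rewrite mVE.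
have genMmin : generates Mmin (secant r (@edge_ideal K n G)).
  exact: minimal_uncolorable_generates.
(* [Mmin] generates and lies in every monomial generating set, so a minimal [M] shrinks to it.
   Conversely, any generating subset of [Mmin] contains [Mmin]. *)
split=> [[monM genM minM] f | MP].
  have MminM g : Mmin g -> M g.
    move=> [V [VP ->]].
    exact: (minimal_uncolorable_mem_generators hr monM genM).
  by split=> [|/MminM //]; apply: minM.
have idealM f : ideal_gen M f <-> ideal_gen Mmin f.
  by split; apply: ideal_gen_trans => g /MP ?; apply: ideal_gen_mem.
split=> [f /MP/monMmin //| f | N NM genN f /MP[V [VP ->]]].
  by rewrite idealM; apply: genMmin.
apply: (minimal_uncolorable_mem_generators hr _ genN VP) => g /NM/MP.
exact: monMmin.
Qed.
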